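(* There does not exist a basic $0,1$ matrix $M$ of size $5\times 5$ with $\mathrm{rank}_{\mathbb{R}}(M) = 3$.
   Context: A $0,1$ matrix is basic if it has no all-zero rows or columns, no two identical rows and no two identical columns. $\mathrm{rank}_{\mathbb{R}}(M)$ is the usual rank over $\mathbb{R}$. *)

(* Defs.v *)
From mathcomp Require Import all_boot all_order all_algebra.
From mathcomp Require Import reals.

Set Implicit Arguments.
Unset Strict Implicit.
Unset Printing Implicit Defensive.

Import GRing.Theory Num.Theory.
Local Open Scope ring_scope.

Definition zero_one_mx (R : realType) (m n : nat) (M : 'M[R]_(m, n)) : Prop :=
  forall i j, M i j = 0 \/ M i j = 1.

Definition basic_mx (R : realType) (m n : nat) (M : 'M[R]_(m, n)) : Prop :=
  [/\ forall i, row i M <> 0,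
      forall j, col j M <> 0,
      forall i1 i2, i1 <> i2 -> row i1 M <> row i2 M
    & forall j1 j2, j1 <> j2 -> col j1 M <> col j2 M].

(* Main.v *)
Require Import Defs.
From mathcomp Require Import all_boot all_order all_algebra.
From mathcomp Require Import reals.

Set Implicit Arguments.
Unset Strict Implicit.
Unset Printing Implicit Defensive.

Import GRing.Theory Num.Theory.
Local Open Scope ring_scope.

(** Three rows of a rank 3 matrix span its row space, so a linear relation
    between the columns of M holds as soon as it holds on these three rows.
    Hence the five columns, restricted to the three rows, are still distinct
    and nonzero: together with the origin they are six of the eight vertices
    of the cube {0,1}^3.  Each row of M is a linear form on R^3 that takes the
    values 0 and 1 on these six vertices and vanishes at the origin, and
    distinct nonzero rows give distinct nonzero forms ([row_form_is_form],
    [row_form_inj]).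

    There are at most four such forms, so that a fifth row is impossible
    ([few_forms_on_six_vertices]).  Indeed, up to the affine symmetries of the
    cube the two missing vertices form an edge, a diagonal of a face or a main
    diagonal, and one counts respectively 10, 8 and 10 affine functions with
    values 0 and 1 on the other six.  The involution f |-> 1 - f halves this
    number when f is required to vanish at the origin, and the zero form is
    one of the remaining 5, 4 or 5.  The formal count does not use the
    symmetries: linearity enters only through the rectangles
    x + y = z + w of the cube, which is a condition on bits, and
    the masks of six vertices are enumerated. *)

(** * Counting forms on six vertices of the cube *)

Fixpoint bitseqs (n : nat) : seq bitseq :=
  if n is m.+1 then
    map (cons false) (bitseqs m) ++ map (cons true) (bitseqs m)
  else [:: [::]].

Lemma mem_bitseqs (n : nat) (s : bitseq) : (s \in bitseqs n) = (size s == n).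
Proof.
elim: n s => [|n IHn] [|b s] //=.
  by rewrite mem_cat; apply/negbTE/norP; split; apply/mapP => -[].
have mem_cons c :
  (b :: s \in map (cons c) (bitseqs n)) = (b == c) && (size s == n).
  apply/mapP/andP => [[t t_in [-> ->]]|[/eqP-> s_in]].
    by rewrite eqxx -IHn.
  by exists s; rewrite ?IHn.
by rewrite mem_cat !mem_cons eqSS; clear mem_cons; case: b; rewrite //= orbF.
Qed.

Definition cube : seq bitseq := bitseqs 3.

Lemma mem_cube (v : bitseq) : (v \in cube) = (size v == 3).
Proof. exact: mem_bitseqs. Qed.

Definition origin : bitseq := nseq 3 false.

Definition same_sum (x y z w : bitseq) : bool :=
  all (fun i => nth false x i + nth false y i
             == nth false z i + nth false w i)%N (iota 0 3).

(** The degenerate rectangles are kept: they impose no condition. *)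
Definition rectangles : seq (bitseq * bitseq * (bitseq * bitseq)) :=
  [seq q <- [seq (a, b) | a <- [seq (x, y) | x <- cube, y <- cube],
                          b <- [seq (z, w) | z <- cube, w <- cube]]
     | same_sum q.1.1 q.1.2 q.2.1 q.2.2].

Lemma mem_pairs (S T : eqType) (s : seq S) (t : seq T) (a : S) (b : T) :
  ((a, b) \in [seq (x, y) | x <- s, y <- t]) = (a \in s) && (b \in t).
Proof.
apply/allpairsP/andP => [[[x y] [/= x_in y_in [-> ->]]] //|[a_in b_in]].
by exists (a, b).
Qed.

Lemma mem_rectangles (x y z w : bitseq) :
  ((x, y), (z, w)) \in rectangles =
    [&& same_sum x y z w, size x == 3, size y == 3, size z == 3 & size w == 3].
Proof. by rewrite mem_filter !mem_pairs !mem_cube -!andbA. Qed.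

(** A Boolean function on the cube is stored as the list of its eight values,
    so that these functions can be enumerated by [bitseqs 8]. *)
Definition at_vertex (f v : bitseq) : bool := nth false f (index v cube).

(** The traces on [s] of nonzero 0-1 valued linear forms are such functions.
    Requiring the value 0 outside [s] makes each trace a single bit sequence,
    so that counting sequences counts traces. *)
Definition is_form_on (s f : bitseq) : bool :=
  [&& all (fun v => at_vertex f v ==> at_vertex s v) cube,
      ~~ at_vertex f origin,
      has (at_vertex f) cube
    & all (fun q => all (at_vertex s) [:: q.1.1; q.1.2; q.2.1; q.2.2] ==>
             (at_vertex f q.1.1 + at_vertex f q.1.2
              == at_vertex f q.2.1 + at_vertex f q.2.2)%N) rectangles].

Lemma few_forms_on_six_vertices :
  all (fun s => (at_vertex s origin && (count id s == 6)) ==>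
                (count (is_form_on s) (bitseqs 8) <= 4)%N) (bitseqs 8).
(* Lazy evaluation: most masks and most functions are rejected by the first
   test, before the rectangles are looked at. *)
Proof. by lazy. Qed.

Lemma at_vertex_map (g : pred bitseq) (v : bitseq) :
  size v = 3 -> at_vertex (map g cube) v = g v.
Proof.
move=> sv; have v_in : v \in cube by rewrite mem_cube sv.
by rewrite /at_vertex (nth_map [::]) ?index_mem // nth_index.
Qed.

(** * Rows as forms on the columns *)

(** The column labelled by the vertex [c j] is identified with this vertex, so
    that a row [r] becomes a function on some vertices, extended by zero. *)
Definition row_form (n : nat) (c : 'I_n -> bitseq) (r : 'I_n -> bool) :
    bitseq :=
  [seq [exists j, (c j == v) && r j] | v <- cube].

Definition vertex_mask (n : nat) (c : 'I_n -> bitseq) : bitseq :=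
  [seq (v == origin) || [exists j, c j == v] | v <- cube].

Section Labels.

Variables (n : nat) (c : 'I_n -> bitseq).
Hypothesis size_c : forall j, size (c j) = 3.
Hypothesis c_inj : injective c.
Hypothesis c_neq0 : forall j, c j != origin.

Lemma count_vertex_mask : count id (vertex_mask c) = n.+1.
Proof.
rewrite count_map.
have -> : n.+1 = size (origin :: codom c) by rewrite /= size_codom card_ord.
rewrite -size_filter; apply: perm_size; apply: uniq_perm.
- exact: filter_uniq.
- rewrite /= (map_inj_uniq c_inj) enum_uniq andbT.
  by apply/codomP => -[j /esym/eqP]; apply/negP.
move=> v; rewrite mem_filter mem_cube /= inE.
have -> : [exists j, c j == v] = (v \in codom c).
  by apply/existsP/codomP => -[j]; [move/eqP<- | move->]; exists j.
apply/andP/idP => [[]//|vin]; split=> //.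
case/orP: vin => [/eqP->//|/codomP[j ->]].
by rewrite size_c.
Qed.

Lemma at_row_form_label (r : 'I_n -> bool) (j : 'I_n) :
  at_vertex (row_form c r) (c j) = r j.
Proof.
rewrite at_vertex_map ?size_c //.
apply/existsP/idP => [[k /andP[/eqP/c_inj->//]]|rj].
by exists j; rewrite eqxx.
Qed.

Lemma at_row_form_origin (r : 'I_n -> bool) :
  at_vertex (row_form c r) origin = false.
Proof.
by rewrite at_vertex_map //; apply/existsP => -[j]; rewrite (negPf (c_neq0 j)).
Qed.

(** The weight vector of a vertex is the unit vector of the column that it
    labels, and zero at the origin: relations between vertices become linear
    relations between columns. *)
Definition vertex_weight (R : pzRingType) (v : bitseq) : 'cV[R]_n :=
  \col_j (c j == v)%:R.

Lemma mul_vertex_weight (R : pzRingType) (m : nat) (b : 'I_m -> 'I_n -> bool)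
    (i : 'I_m) (v : bitseq) :
  size v = 3 ->
  ((\matrix_(i, j) (b i j)%:R : 'M[R]_(m, n)) *m vertex_weight R v) i 0
    = (at_vertex (row_form c (b i)) v)%:R.
Proof.
move=> sv; rewrite mxE.
case: (pickP (fun j => c j == v)) => [j /eqP <-|nov].
  rewrite at_row_form_label (bigD1 j) //= big1 ?addr0 => [|k kj].
    by rewrite !mxE eqxx mulr1.
  by rewrite !mxE (inj_eq c_inj) (negPf kj) mulr0.
rewrite big1 => [|j _]; last by rewrite !mxE nov mulr0.
rewrite at_vertex_map //; case: existsP => // -[j].
by rewrite nov.
Qed.

End Labels.

(** * Rank and the three spanning rows *)

Lemma spanning_rows (F : fieldType) (m n r : nat) (M : 'M[F]_(m, n)) :
  \rank M = r ->
  exists f : 'I_r -> 'I_m,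
    forall k : 'cV[F]_n, rowsub f M *m k = 0 -> M *m k = 0.
Proof.
move=> <-; exists (maxrankfun M) => k fk0.
have /submxP[D ->] : (M <= rowsub (maxrankfun M) M)%MS by rewrite eq_maxrowsub.
by rewrite -mulmxA fk0 mulmx0.
Qed.

Section Rank3.

Variables (R : realType) (m n : nat) (b : 'I_m -> 'I_n -> bool).
Let M : 'M[R]_(m, n) := \matrix_(i, j) (b i j)%:R.
Variable f : 'I_3 -> 'I_m.
Hypothesis f_spans : forall k : 'cV[R]_n, rowsub f M *m k = 0 -> M *m k = 0.
Hypothesis M_basic : basic_mx M.

Definition label (j : 'I_n) : bitseq := mkseq (fun t => b (f (inord t)) j) 3.

Lemma nth_label (t : 'I_3) (j : 'I_n) : nth false (label j) t = b (f t) j.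
Proof. by rewrite nth_mkseq // inord_val. Qed.

Lemma size_label (j : 'I_n) : size (label j) = 3.
Proof. exact: size_mkseq. Qed.

(** Two columns with the same label differ by a relation that holds on the
    spanning rows, hence everywhere: they would be identical. *)
Lemma label_inj : injective label.
Proof.
case: M_basic => _ _ _ col_neq j1 j2 eq12.
apply/eqP/negPn/negP => /eqP/col_neq; apply.
suff /eqP : M *m (delta_mx j1 0 - delta_mx j2 0) = 0 :> 'cV_m.
  by rewrite mulmxBr -!colE subr_eq0 => /eqP.
apply: f_spans; apply/colP => t.
by rewrite mulmxBr -!colE !mxE -!nth_label eq12 subrr.
Qed.

Lemma label_neq_origin (j : 'I_n) : label j != origin.
Proof.
case: M_basic => _ col_neq0 _ _; apply/eqP => lj; apply: (col_neq0 j).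
rewrite colE; apply: f_spans; apply/colP => t.
rewrite -colE !mxE -nth_label lj.
by case: t => [[|[|[]]]].
Qed.

(** The spanning rows are the coordinate forms: this turns the condition
    [same_sum] on vertices into a relation between entries of these rows. *)
Lemma at_spanning_row_form (t : 'I_3) (v : bitseq) :
  size v = 3 -> at_vertex (vertex_mask label) v ->
  at_vertex (row_form label (b (f t))) v = nth false v t.
Proof.
move=> sv; rewrite at_vertex_map // => /orP[/eqP->|/existsP[j /eqP <-]].
  rewrite at_row_form_origin; last exact: label_neq_origin.
  by case: t => [[|[|[]]]].
by rewrite (at_row_form_label size_label label_inj) nth_label.
Qed.

(** A rectangle x + y = z + w of labelled vertices is a linear relation between
    columns that holds on the spanning rows, hence in the row [i]. *)
Lemma row_form_is_form (i : 'I_m) :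
  is_form_on (vertex_mask label) (row_form label (b i)).
Proof.
have sz := size_label; have inj := label_inj; have neq0 := label_neq_origin.
apply/and4P; split.
- apply/allP => v; rewrite mem_cube => /eqP sv; rewrite !at_vertex_map //.
  apply/implyP => /existsP[j /andP[cj _]]; apply/orP; right.
  by apply/existsP; exists j.
- by rewrite at_row_form_origin.
- case: M_basic => row_neq0 _ _ _; apply/negPn/negP => /hasPn f0.
  apply: (row_neq0 i); apply/rowP => j; rewrite !mxE.
  have /f0 : label j \in cube by rewrite mem_cube sz.
  by rewrite at_row_form_label // => /negPf->.
apply/allP => -[[x y] [z w]]; rewrite mem_rectangles.
case/and5P => xyzw /eqP sx /eqP sy /eqP sz' /eqP sw.
apply/implyP => /and5P[mx my mz mw _].
pose W := vertex_weight label R.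
have weight_relation k : (M *m (W x + W y - (W z + W w))) k 0
    = (at_vertex (row_form label (b k)) x)%:R
      + (at_vertex (row_form label (b k)) y)%:R
      - ((at_vertex (row_form label (b k)) z)%:R
         + (at_vertex (row_form label (b k)) w)%:R).
  by rewrite mulmxBr !mulmxDr -!(mul_vertex_weight sz inj) // !(mxE, opprD).
have : M *m (W x + W y - (W z + W w)) = 0.
  apply: f_spans; rewrite mul_rowsub_mx; apply/colP => t.
  rewrite [LHS]mxE [RHS]mxE weight_relation !at_spanning_row_form //.
  have /eqP sum_t : (nth false x t + nth false y t
                     == nth false z t + nth false w t)%N.
    by apply: (allP xyzw); rewrite mem_iota ltn_ord.
  by rewrite -!natrD sum_t subrr.
move/colP/(_ i); rewrite weight_relation [RHS]mxE -!natrD.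
by move/eqP; rewrite subr_eq0 eqr_nat.
Qed.

Lemma row_form_inj : injective (fun i => row_form label (b i)).
Proof.
case: M_basic => _ _ row_neq _ i1 i2 eq12.
apply/eqP/negPn/negP => /eqP/row_neq; apply; apply/rowP => j.
rewrite !mxE; congr (_ %:R); congr nat_of_bool.
by rewrite -!(at_row_form_label size_label label_inj _ j) eq12.
Qed.

End Rank3.

Theorem lemma17 (R : realType) :
  ~ exists M : 'M[R]_5, [/\ zero_one_mx M, basic_mx M & \rank M = 3%N].
Proof.
case=> M [M01 M_basic rkM].
have [f f_spans] := spanning_rows rkM.
pose b i j := M i j == 1.
have defM : M = \matrix_(i, j) (b i j)%:R.
  apply/matrixP => i j; rewrite mxE /b.
  by case: (M01 i j) => ->; rewrite ?eqxx // eq_sym oner_eq0.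
rewrite {}defM in M_basic f_spans.
pose c := label b f; pose s := vertex_mask c.
pose forms := [seq row_form c (b i) | i <- enum 'I_5].
have forms_uniq : uniq forms.
  by rewrite map_inj_uniq ?enum_uniq //; apply: row_form_inj f_spans M_basic.
have forms_sub : {subset forms <= [seq g <- bitseqs 8 | is_form_on s g]}.
  move=> _ /mapP[i _ ->]; rewrite mem_filter mem_bitseqs size_map eqxx andbT.
  exact: row_form_is_form f_spans M_basic _.
have := uniq_leq_size forms_uniq forms_sub.
rewrite size_map -cardE card_ord size_filter leqNgt ltnS => /negP; apply.
have /(allP few_forms_on_six_vertices)/implyP : s \in bitseqs 8.
  by rewrite mem_bitseqs size_map.
have c_size j : size (c j) = 3 by exact: size_label.
have c_inj : injective c by exact: label_inj f_spans M_basic.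
have c_neq0 j : c j != origin by exact: label_neq_origin f_spans M_basic _.
by apply; rewrite at_vertex_map // (count_vertex_mask c_size c_inj c_neq0).
Qed.
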